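(* Consider a finite MDP $\langle\mathcal S,\mathcal A,(\mathcal A(s),s\in\mathcal S),P,r\rangle$ (with $r$ interpreted as a cost), a horizon $T\ge1$ and $\alpha\in(0,1]$. (a) The optimal value function $\mathrm{VaR}^*(s_0):=\inf_{u\in\mathcal U^{\rm RH}}\mathrm{VaR}^u(s_0)$ of the finite-horizon VaR minimization MDP is given by $$\mathrm{VaR}^*(s_0)=\min_{\lambda_0\in\Lambda_0}\Big\{\lambda_0:\ \max_{\tilde u\in\tilde{\mathcal U}^{\rm DM}}V_0^{\tilde u}(s_0,\lambda_0)\ge\alpha\Big\},\qquad s_0\in\mathcal S.$$ (b) Suppose $\tilde u^*=(\tilde u^*_0,\dots,\tilde u^*_{T-1})\in\tilde{\mathcal U}^{\rm DM}$ is an optimal deterministic Markov policy of the augmented maximization MDP, i.e. $V_0^{\tilde u^*}(s_0,\lambda_0)=\sup_{\tilde u\in\tilde{\mathcal U}^{\rm RH}}V_0^{\tilde u}(s_0,\lambda_0)$ for all $(s_0,\lambda_0)\in\mathcal S\times\mathbb R$. Then the deterministic history-dependent policy $u^*=(u_0^*,\dots,u_{T-1}^* )\in\mathcal U^{\rm DH}$ given by $$u_t^*(s_0,a_0,\dots,s_t)=\tilde u_t^*\Big(s_t,\ \mathrm{VaR}^*(s_0)-\sum_{\tau=0}^{t-1}r(s_\tau,a_\tau)\Big),\qquad t=0,\dots,T-1,$$ is optimal for the finite-horizon VaR minimization MDP, i.e. $\mathrm{VaR}^{u^*}(s_0)=\mathrm{VaR}^*(s_0)$ for all $s_0\in\mathcal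 S$.
   Context: MDP: $\mathcal S$ and $\mathcal A$ are finite sets; $\mathcal A(s)\subseteq\mathcal A$ is the nonempty set of admissible actions in $s$, with $\cup_s\mathcal A(s)=\mathcal A$; $\mathcal K:=\{(s,a):s\in\mathcal S,a\in\mathcal A(s)\}$; $P(\cdot|s,a)$ is a probability distribution on $\mathcal S$ for each $(s,a)\in\mathcal K$; $r:\mathcal K\to\mathbb R$ is the instantaneous cost. Policies: $\mathcal U^{\rm RH}$ is the set of randomized history-dependent policies $u=(u_t)_{t}$, where $u_t(\cdot|h_t)$ is a probability distribution on $\mathcal A(s_t)$ for each history $h_t=(s_0,a_0,\dots,s_{t-1},a_{t-1},s_t)\in\mathcal K^t\times\mathcal S$; $\mathcal U^{\rm DH}$ is the subset of deterministic ones ($u_t(h_t)\in\mathcal A(s_t)$). $\mathbb P^u_{s_0}$ is the law of $(s_0,a_0,s_1,a_1,\dots)$ under $u$ started from $s_0$. Finite-horizon quantities: $R_{0:T}:=\sum_{t=0}^{T-1}r(s_t,a_t)$ (the terminal cost is zero); $\Lambda_0:=\{\sum_{t=0}^{T-1}r(s_t,a_t):(s_t,a_t)\in\mathcal K\text{ for all }t\}$; $\mathrm{VaR}^u(s_0):=\inf\{\lambda\in\mathbb R:\mathbb P^u_{s_0}(R_{0:T}\le\lambda)\ge\alpha\}$. Augmented MDP: state space $\tilde{\mathcal S}:=\mathcal S\times\mathbb R$, admissible actions $\mathcal A(s)$ in state $(s,\lambda)$; from $(s_t,\lambda_t)$ with action $a_t$ the next state is $(s_{t+1},\lambda_{t+1})$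 with $s_{t+1}\sim P(\cdot|s_t,a_t)$ and $\lambda_{t+1}=\lambda_t-r(s_t,a_t)$, $t=0,\dots,T-1$; the only nonzero reward is the terminal reward $\mathbb I\{0\le\lambda_T\}$. $\tilde{\mathcal U}^{\rm RH}$ is the set of randomized policies depending on the history $(s_0,\lambda_0,a_0,\dots,s_t,\lambda_t)$; $\tilde{\mathcal U}^{\rm DM}$ is the set of deterministic Markov policies $\tilde u=(\tilde u_0,\dots,\tilde u_{T-1})$, $\tilde u_t:\mathcal S\times\mathbb R\to\mathcal A$ with $\tilde u_t(s,\lambda)\in\mathcal A(s)$. $V_0^{\tilde u}(s_0,\lambda_0):=\mathbb E^{\tilde u}_{s_0,\lambda_0}[\mathbb I\{0\le\lambda_T\}]=\mathbb P^{\tilde u}_{s_0,\lambda_0}\big(\sum_{t=0}^{T-1}r(s_t,a_t)\le\lambda_0\big)$. *)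

(* Defs.v *)
From HB Require Import structures.
From mathcomp Require Import all_boot all_order all_algebra.
From mathcomp Require Import classical_sets reals.

Set Implicit Arguments.
Unset Strict Implicit.
Unset Printing Implicit Defensive.

Import Order.TTheory GRing.Theory Num.Theory.
Local Open Scope classical_set_scope.
Local Open Scope ring_scope.

Definition is_distr (R : realType) (X : finType) (D : pred X) (p : X -> R) :=
  [/\ forall x, 0 <= p x, forall x, ~~ D x -> p x = 0 & \sum_x p x = 1].

Definition is_min (R : realType) (X : set R) (m : R) := X m /\ lbound X m.
Definition is_max (R : realType) (X : set R) (m : R) := X m /\ ubound X m.

(* The set of admissible state-action pairs, as a finite type. *)
Definition adm_pair (S A : finType) (adm : S -> {set A}) :=
  {sa : S * A | sa.2 \in adm sa.1}.

Record mdp (R : realType) (S A : finType) := MDP {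
  adm : S -> {set A};
  adm_nonempty : forall s, exists a, a \in adm s;
  adm_cover : forall a, exists s, a \in adm s;
  trans : adm_pair adm -> S -> R;
  trans_distr : forall k, is_distr xpredT (trans k);
  cost : adm_pair adm -> R }.

Section Mdp.
Variables (R : realType) (S A : finType) (M : mdp R S A) (T : nat).

Definition K : finType := adm_pair (adm M).
Definition pst (k : K) : S := (val k).1.
Definition pact (k : K) : A := (val k).2.

(* A history (s_0, a_0, ..., s_{t-1}, a_{t-1}, s_t) is a sequence h : seq K
   together with s_t : S; the time t is size h. The values of a policy at times
   t >= T are never used and are left unconstrained. *)
Definition rpolicy := seq K -> S -> A -> R.
Definition dpolicy := seq K -> S -> A.

Definition U_RH : set rpolicy := [set u |
  forall h s, (size h < T)%N -> is_distr [in adm M s] (u h s)].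

Definition U_DH : set dpolicy := [set u |
  forall h s, (size h < T)%N -> u h s \in adm M s].

Definition dirac_policy (u : dpolicy) : rpolicy :=
  fun h s a => (a == u h s)%:R.

(* ((s_0, a_0), ..., (s_{T-1}, a_{T-1})) and s_T *)
Definition traj : finType := (T.-tuple K * S)%type.

(* s_t for t <= T; the default value of nth provides s_T *)
Definition state (w : traj) (t : nat) : S := nth w.2 (map pst w.1) t.

(* The law of (s_0, a_0, ..., a_{T-1}, s_T) under u, started from s0. *)
Definition law (u : rpolicy) (s0 : S) (w : traj) : R :=
  (state w 0 == s0)%:R *
  \prod_(t < T) (u (take t w.1) (state w t) (pact (tnth w.1 t)) *
                 trans (tnth w.1 t) (state w t.+1)).

Definition prob (u : rpolicy) (s0 : S) (E : pred traj) : R :=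
  \sum_(w | E w) law u s0 w.

Definition total_cost (w : traj) : R := \sum_(t < T) cost (tnth w.1 t).

Definition Lambda0 : set R :=
  [set lam | exists k : T.-tuple K, lam = \sum_(t < T) cost (tnth k t)].

(* For 0 < alpha <= 1, 1 <= T and u in U_RH, the sets whose infima are taken in
   VaR and VaR_opt are nonempty and bounded below, so that inf is the genuine
   infimum. *)
Definition VaR (alpha : R) (u : rpolicy) (s0 : S) : R :=
  inf [set lam | alpha <= prob u s0 [pred w | total_cost w <= lam]].

Definition VaR_opt (alpha : R) (s0 : S) : R :=
  inf [set VaR alpha u s0 | u in U_RH].

(* Augmented MDP, with states (s, lam) in S * R. A history
   (s_0, lam_0, a_0, ..., s_t, lam_t) is a sequence over K * R, whose items
   gather (s_i, a_i) and lam_i for i < t, together with (s_t, lam_t). *)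
Definition aug_rpolicy := seq (K * R) -> S * R -> A -> R.
Definition aug_dmpolicy := nat -> S * R -> A.

Definition aug_RH : set aug_rpolicy := [set u |
  forall h x, (size h < T)%N -> is_distr [in adm M x.1] (u h x)].

Definition aug_DM : set aug_dmpolicy := [set u |
  forall t x, (t < T)%N -> u t x \in adm M x.1].

Definition aug_dirac (u : aug_dmpolicy) : aug_rpolicy :=
  fun h x a => (a == u (size h) x)%:R.

Definition next_level (lam : R) (k : K) : R := lam - cost k.

(* lam_t, reached from lam_0 = lam through h = ((s_0, a_0), ..., (s_{t-1},
   a_{t-1})) *)
Definition level (lam : R) (h : seq K) : R := foldl next_level lam h.

Fixpoint aug_hist (lam : R) (h : seq K) : seq (K * R) :=
  if h is k :: h' then (k, lam) :: aug_hist (next_level lam k) h' else [::].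

(* The level component evolves deterministically, so that a trajectory of the
   augmented MDP from (s0, lam0) is determined by its (s, a)-components w. *)
Definition aug_law (u : aug_rpolicy) (s0 : S) (lam0 : R) (w : traj) : R :=
  (state w 0 == s0)%:R *
  \prod_(t < T) (u (aug_hist lam0 (take t w.1))
                   (state w t, level lam0 (take t w.1)) (pact (tnth w.1 t)) *
                 trans (tnth w.1 t) (state w t.+1)).

Definition V0 (u : aug_rpolicy) (s0 : S) (lam0 : R) : R :=
  \sum_(w : traj) aug_law u s0 lam0 w * (0 <= level lam0 w.1)%R%:R.

Definition aug_optimal (u : aug_dmpolicy) : Prop :=
  forall s0 lam0, V0 (aug_dirac u) s0 lam0 = sup [set V0 v s0 lam0 | v in aug_RH].

(* head s (map pst h) is s_0 : it is s itself when the history h is empty. *)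
Definition induced_policy (alpha : R) (u : aug_dmpolicy) : dpolicy :=
  fun h s =>
    u (size h) (s, VaR_opt alpha (head s (map pst h)) - \sum_(k <- h) cost k).

End Mdp.

Arguments U_RH {R S A} M T.
Arguments U_DH {R S A} M T.
Arguments Lambda0 {R S A} M T.
Arguments VaR {R S A} M T alpha u s0.
Arguments VaR_opt {R S A} M T alpha s0.
Arguments aug_RH {R S A} M T.
Arguments aug_DM {R S A} M T.
Arguments V0 {R S A} M T u s0 lam0.
Arguments aug_optimal {R S A} M T u.
Arguments induced_policy {R S A} M T alpha u _ _.

(* Main.v *)
(* Averaging over the first step gives a dynamic-programming recursion in which
   the tail of a history-dependent policy is again a policy, started at the level
   lam - cost k. Hence the probability P^u(R_{0:T} <= lam) is at most the
   Bellman value opt T s lam for every randomized history-dependent u, with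
   equality for the greedy policy that tracks the remaining level. Both the
   augmented problem and the VaR problem thus share the value opt, because an
   augmented policy from a fixed lam0 is an ordinary history-dependent policy.
   Since R_{0:T} takes values in the finite set Lambda0, any level reached with
   probability at least alpha can be lowered to a point of Lambda0 with the same
   probability, so the least lam in Lambda0 with alpha <= opt T s lam bounds the
   VaR of every policy from below, and it is attained by any policy reaching opt
   at that level. *)
Require Import Defs.
From mathcomp Require Import all_boot all_order all_algebra.
From mathcomp Require Import classical_sets reals.

Import Order.TTheory GRing.Theory Num.Theory.
Local Open Scope classical_set_scope.
Local Open Scope ring_scope.

Section Trajectories.
Set Implicit Arguments.
Unset Strict Implicit.
Variables (R : realType) (S A : finType) (M : mdp R S A).
Implicit Types (u : rpolicy M) (k : K M) (s : S) (lam : R).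

(** * First-step decomposition of the trajectory law *)

Definition shift_policy k u : rpolicy M := fun h => u (k :: h).

Definition cons_traj T k (w : traj M T) : traj M T.+1 :=
  (cons_tuple k w.1, w.2).

Definition expect T u s (f : traj M T -> R) : R := \sum_w law u s w * f w.

Lemma state_cons T k (w : traj M T) t :
  state (cons_traj k w) t.+1 = state w t.
Proof. by []. Qed.

(** The law of [w] from [s'] vanishes unless [w] starts at [s'], so a single term of the sum
    survives; keeping the sum lets the tail be integrated from each [s'] separately. *)
Lemma law_cons T u s k (w : traj M T) :
  law u s (cons_traj k w) =
  (pst k == s)%:R * u [::] s (pact k) *
  \sum_s' trans k s' * law (shift_policy k u) s' w.
Proof.
rewrite /law big_ord_recl /= (bigD1 (state w 0)) //= eqxx mul1r.
rewrite [\sum_(_ | _ != _) _]big1 ?addr0; last first.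
  by move=> s' /negbTE ne; rewrite eq_sym ne mul0r mulr0.
have -> : state (cons_traj k w) 0 = pst k by [].
rewrite tnth0 -!mulrA.
case: eqP => [->|_]; last by rewrite !mul0r.
congr (_ * (_ * (_ * _))).
apply: eq_bigr => t _.
by rewrite tnthS /bump /= add1n !state_cons.
Qed.

Lemma expect_cons T u s (f : traj M T.+1 -> R) :
  expect u s f =
  \sum_(k | pst k == s) u [::] s (pact k) *
    \sum_s' trans k s' * expect (shift_policy k u) s' (f \o cons_traj k).
Proof.
rewrite /expect (reindex (fun p : K M * traj M T => cons_traj p.1 p.2)) /=; last first.
  exists (fun w : traj M T.+1 => (thead w.1, (behead_tuple w.1, w.2))).
    by move=> [k [h s']] _ /=; congr (_, (_, _)); apply: val_inj.
  by move=> [h s'] _; rewrite /cons_traj /= [h in RHS]tuple_eta; congr (_, _); apply: val_inj.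
rewrite -(pair_bigA _ (fun k w => law u s (cons_traj k w) * f (cons_traj k w))) /=.
rewrite [RHS]big_mkcond /=; apply: eq_bigr => k _.
case: ifP => pk; last first.
  by apply: big1 => w _; rewrite law_cons pk !mul0r.
under eq_bigr do rewrite law_cons pk mul1r -mulrA mulr_suml.
rewrite -mulr_sumr exchange_big /=; congr (_ * _).
by apply: eq_bigr => s' _; rewrite mulr_sumr; apply: eq_bigr => w _; rewrite mulrA.
Qed.

Lemma expect_nil u s (f : traj M 0 -> R) : expect u s f = f ([tuple], s).
Proof.
rewrite /expect (bigD1 ([tuple], s)) //= big1 ?addr0.
  by rewrite /law big_ord0 /state /= eqxx !mul1r.
move=> [h s'] /=; rewrite tuple0 /law big_ord0 /state /= mulr1 xpair_eqE.
by rewrite eqxx /= => /negbTE ->; rewrite mul0r.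
Qed.

Lemma U_RH_shift T k u : U_RH M T.+1 u -> U_RH M T (shift_policy k u).
Proof. by move=> hu h s hs; apply: hu. Qed.

(** Through [pact], the pairs above [s] are in bijection with the admissible actions, and [p] has no
    mass elsewhere. *)
Lemma sum_pact (p : A -> R) s : (forall a, a \notin adm M s -> p a = 0) ->
  \sum_(k : K M | pst k == s) p (pact k) = \sum_a p a.
Proof.
move=> p0; rewrite [RHS](bigID [in adm M s]) /= [X in _ + X]big1 ?addr0; last exact: p0.
rewrite (reindex_omap (fun k : K M => pact k)
  (fun a => insub (s, a) : option (K M))) /=; last first.
  by move=> a ha; rewrite insubT.
apply: eq_bigl => -[[s' a] ha]; rewrite /pst /pact /=; apply/idP/andP.
  by move=> /eqP <-; rewrite ha insubT; split=> //; apply/eqP; congr Some; apply: val_inj.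
by move=> [ha']; rewrite insubT => /eqP [->].
Qed.

Lemma sum_policy T u s : (0 < T)%N -> U_RH M T u ->
  \sum_(k : K M | pst k == s) u [::] s (pact k) = 1.
Proof.
move=> T0 hu; have [_ u0 u1] := hu [::] s T0.
by rewrite sum_pact.
Qed.

Lemma expect_cst T u s c : U_RH M T u -> expect u s (fun _ : traj M T => c) = c.
Proof.
elim: T u s => [|T IH] u s hu; first by rewrite expect_nil.
rewrite expect_cons -[RHS]mul1r -(sum_policy s (ltn0Sn T) hu) mulr_suml.
apply: eq_bigr => k _; congr (_ * _).
rewrite -[RHS]mul1r; have [_ _ <-] := trans_distr k; rewrite mulr_suml.
by apply: eq_bigr => s' _; rewrite IH //; exact: U_RH_shift.
Qed.

Lemma total_cost_cons T k (w : traj M T) :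
  total_cost (cons_traj k w) = cost k + total_cost w.
Proof.
by rewrite /total_cost big_ord_recl tnth0; congr (_ + _); apply: eq_bigr => t _; rewrite tnthS.
Qed.

(** * Success probabilities and their one-step recursion *)

Definition success T u s lam : R := prob u s [pred w : traj M T | total_cost w <= lam].

Lemma successE T u s lam :
  success T u s lam = expect u s (fun w : traj M T => (total_cost w <= lam)%R%:R).
Proof.
rewrite /success /prob big_mkcond /=; apply: eq_bigr => w _.
by case: ifP; rewrite ?mulr1 ?mulr0.
Qed.

Lemma success0 u s lam : success 0 u s lam = (0 <= lam)%R%:R.
Proof. by rewrite successE expect_nil /total_cost big_ord0. Qed.

Lemma successS T u s lam :
  success T.+1 u s lam =
  \sum_(k | pst k == s) u [::] s (pact k) *
    \sum_s' trans k s' * success T (shift_policy k u) s' (lam - cost k).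
Proof.
rewrite successE expect_cons; apply: eq_bigr => k _; congr (_ * _).
apply: eq_bigr => s' _; congr (_ * _); rewrite successE.
by apply: eq_bigr => w _; rewrite /= total_cost_cons lerBrDl.
Qed.

(** * Bellman values and a greedy policy attaining them *)

Lemma adm_pair_exists s : exists k : K M, pst k == s.
Proof. by have [a ha] := adm_nonempty M s; exists (Sub (s, a) ha) => /=. Qed.

Definition best_pair (f : K M -> R) s : K M :=
  [arg max_(k > xchoose (adm_pair_exists s) | pst k == s) f k]%O.

Lemma best_pairP f s :
  pst (best_pair f s) = s /\ forall k, pst k = s -> f k <= f (best_pair f s).
Proof.
rewrite /best_pair; case: arg_maxP => [|k /eqP pk max].
  exact: (xchooseP (adm_pair_exists s)).
by split=> // k' /eqP; apply: max.
Qed.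

(** The local [q] is [opt_q T' lam], inlined because it calls [opt] recursively. *)
Fixpoint opt T s lam : R :=
  if T is T'.+1 then
    let q k := \sum_s' trans k s' * opt T' s' (lam - cost k) in q (best_pair q s)
  else (0 <= lam)%R%:R.

Definition opt_q T lam k : R := \sum_s' trans k s' * opt T s' (lam - cost k).

(** Induction on the horizon: [opt] bounds the tail policy from each successor, and a convex
    combination of the values [opt_q] is at most their maximum. *)
Lemma success_le_opt T u s lam : U_RH M T u -> success T u s lam <= opt T s lam.
Proof.
elim: T u s lam => [|T IH] u s lam hu; first by rewrite success0.
rewrite successS -[leRHS]mul1r -(sum_policy s (ltn0Sn T) hu) mulr_suml.
apply: ler_sum => k /eqP pk; have [u0 _ _] := hu [::] s (ltn0Sn T).
apply: ler_wpM2l => //; apply: le_trans (proj2 (best_pairP (opt_q T lam) s) k pk).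
apply: ler_sum => s' _; have [tr0 _ _] := trans_distr k.
by apply: ler_wpM2l => //; apply: IH; apply: U_RH_shift.
Qed.

Definition level_policy lam (g : aug_dmpolicy R S A) : dpolicy M :=
  fun h s => g (size h) (s, lam - \sum_(k <- h) cost k).

(* T is the number of stages left at time 0; the value at times t >= T is an
   arbitrary admissible action. *)
Fixpoint greedy T t (x : S * R) : A :=
  if T is T'.+1 then
    if t is t'.+1 then greedy T' t' x else pact (best_pair (opt_q T' x.2) x.1)
  else pact (xchoose (adm_pair_exists x.1)).

Lemma adm_pact k s : pst k = s -> pact k \in adm M s.
Proof. by move=> <-; exact: valP k. Qed.

Lemma greedy_DM T n : aug_DM M n (greedy T).
Proof.
move=> t x _; elim: T t => [|T IH] [|t] //=; apply: adm_pact.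
- by apply/eqP; exact: (xchooseP (adm_pair_exists x.1)).
- by apply/eqP; exact: (xchooseP (adm_pair_exists x.1)).
- by have [] := best_pairP (opt_q T x.2) x.1.
Qed.

Lemma pair_inj k k' : pst k = pst k' -> pact k = pact k' -> k = k'.
Proof.
move: k k' => [[s a] h] [[s' a'] h']; rewrite /pst /pact /= => e e'.
by apply: val_inj; rewrite /= e e'.
Qed.

(** After the best first pair, the tail is the greedy policy with one stage less, at the level
    lowered by the cost of that pair. *)
Lemma success_greedy T s lam :
  success T (dirac_policy (level_policy lam (greedy T))) s lam = opt T s lam.
Proof.
elim: T s lam => [|T IH] s lam; first by rewrite success0.
have [pb _] := best_pairP (opt_q T lam) s.
rewrite successS (bigD1 (best_pair (opt_q T lam) s)) /=; last by rewrite pb.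
rewrite [\sum_(_ | _ && _) _]big1 ?addr0 => [|k /andP[/eqP pk nk]]; last first.
  rewrite /dirac_policy /level_policy /= big_nil subr0.
  case: eqP => [e|]; last by rewrite mul0r.
  by rewrite (pair_inj (etrans pk (esym pb)) e) eqxx in nk.
rewrite /dirac_policy {1}/level_policy /= big_nil subr0 eqxx mul1r.
apply: eq_bigr => s' _; congr (_ * _); rewrite -IH /success /prob.
apply: eq_bigr => w _; congr (_ * _); apply: eq_bigr => t _; congr (_ * _).
by rewrite /shift_policy /dirac_policy /level_policy /= big_cons opprD addrA.
Qed.

(** * Augmented policies as history-dependent policies *)

Lemma levelE lam (h : seq (K M)) : level lam h = lam - \sum_(k <- h) cost k.
Proof.
elim: h lam => [|k h IH] lam; first by rewrite /level /= big_nil subr0.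
by rewrite /level /= -/(level _ _) IH big_cons opprD addrA.
Qed.

Lemma size_aug_hist lam (h : seq (K M)) : size (aug_hist lam h) = size h.
Proof. by elim: h lam => //= k h IH lam; rewrite IH. Qed.

(* From a fixed initial level, the augmented history is a function of the
   state-action history. *)
Definition unaugment lam (u : aug_rpolicy M) : rpolicy M :=
  fun h s => u (aug_hist lam h) (s, level lam h).

Lemma unaugment_RH T lam (u : aug_rpolicy M) :
  aug_RH M T u -> U_RH M T (unaugment lam u).
Proof. by move=> hu h s hs; apply: hu; rewrite size_aug_hist. Qed.

Lemma V0_success T (u : aug_rpolicy M) s lam :
  V0 M T u s lam = success T (unaugment lam u) s lam.
Proof.
rewrite successE; apply: eq_bigr => w _; congr (_ * _).
by rewrite levelE subr_ge0 /total_cost big_tuple.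
Qed.

Lemma V0_dirac T (g : aug_dmpolicy R S A) s lam :
  V0 M T (aug_dirac g) s lam = success T (dirac_policy (level_policy lam g)) s lam.
Proof.
rewrite V0_success; apply: eq_bigr => w _; congr (_ * _); apply: eq_bigr => t _.
by rewrite /unaugment /aug_dirac size_aug_hist levelE.
Qed.

Lemma dirac_distr s a : a \in adm M s ->
  is_distr [in adm M s] (fun a' => (a' == a)%:R : R).
Proof.
move=> ha; split=> [a'|a' /negP na'|]; first exact: ler0n.
  by case: eqP => // e; case: na'; rewrite e.
by rewrite (bigD1 a) //= eqxx big1 ?addr0 // => a' /negbTE ->.
Qed.

Lemma aug_dirac_RH T (g : aug_dmpolicy R S A) :
  aug_DM M T g -> aug_RH M T (aug_dirac g).
Proof. by move=> hg h x hs; apply: dirac_distr; apply: hg. Qed.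

Lemma dirac_policy_RH T (u : dpolicy M) : U_DH M T u -> U_RH M T (dirac_policy u).
Proof. by move=> hu h s hs; apply: dirac_distr; apply: hu. Qed.

Lemma level_policy_DH T lam (g : aug_dmpolicy R S A) :
  aug_DM M T g -> U_DH M T (level_policy lam g).
Proof. by move=> hg h s hs; apply: hg. Qed.

Lemma V0_greedy T s lam : V0 M T (aug_dirac (greedy T)) s lam = opt T s lam.
Proof. by rewrite V0_dirac success_greedy. Qed.

Lemma V0_le_opt T (u : aug_rpolicy M) s lam : aug_RH M T u -> V0 M T u s lam <= opt T s lam.
Proof. by move=> hu; rewrite V0_success; apply/success_le_opt/unaugment_RH. Qed.

(** The bound [opt] is attained by the deterministic Markov policy [greedy], so randomization and
    memory bring no gain. *)
Lemma sup_V0 T s lam : sup [set V0 M T v s lam | v in aug_RH M T] = opt T s lam.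
Proof.
have attained : [set V0 M T v s lam | v in aug_RH M T] (opt T s lam).
  exists (aug_dirac (greedy T)); last exact: V0_greedy.
  exact/aug_dirac_RH/greedy_DM.
apply/le_anti/andP; split.
  by apply: ge_sup => [|_ [v hv <-]]; [exists (opt T s lam) | exact: V0_le_opt].
by apply: ub_le_sup => //; exists (opt T s lam) => _ [v hv <-]; exact: V0_le_opt.
Qed.

Lemma head_state T (w : traj M T) t : (t < T)%N ->
  head (state w t) (map (@pst _ _ _ M) (take t w.1)) = state w 0.
Proof.
case: w => h s; case: t => [|t] ht; first by rewrite take0.
by case: h => -[|k h] //= /eqP hT; rewrite -hT in ht.
Qed.

(** The induced policy reads its initial level off the first state of the history, which is [s] on
    every trajectory of nonzero law. *)
Lemma success_induced T alpha (g : aug_dmpolicy R S A) s lam :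
  success T (dirac_policy (induced_policy M T alpha g)) s lam =
  success T (dirac_policy (level_policy (VaR_opt M T alpha s) g)) s lam.
Proof.
apply: eq_bigr => w _; rewrite /law.
case: (state w 0 =P s) => [ws|_]; last by rewrite !mul0r.
congr (_ * _); apply: eq_bigr => t _; congr (_ * _).
by rewrite /dirac_policy /induced_policy head_state // ws.
Qed.

(** * Levels that matter: lowering into [Lambda0], and a level reached surely *)

Lemma success_Lambda0 T u s lam : 0 < success T u s lam ->
  exists2 lam', Lambda0 M T lam' /\ lam' <= lam
              & success T u s lam' = success T u s lam.
Proof.
case: (pickP [pred w : traj M T | total_cost w <= lam]) => /= [w0 hw0 _|no]; last first.
  by rewrite /success /prob big_pred0 ?ltxx.
(* The new level is the largest total cost not exceeding [lam]; no total cost lies strictly between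
   the two, so both events coincide. *)
case: (@arg_maxP _ _ _ w0 [pred w | total_cost w <= lam] (@total_cost _ _ _ M T) hw0).
move=> w /= hw wmax; exists (total_cost w); first by split => //; exists w.1.
apply: eq_bigl => w' /=; apply/idP/idP => [h|]; [exact: le_trans h hw | exact: wmax].
Qed.

Lemma success_eventually1 T :
  exists lam, forall u s, U_RH M T u -> success T u s lam = 1.
Proof.
(* A crude bound on all total costs, uniform in the policy and the initial state. *)
exists (\sum_(w : traj M T) `|total_cost w|) => u s hu.
rewrite successE -[RHS](@expect_cst T u s 1 hu); apply: eq_bigr => w _; congr (_ * _).
suff -> : total_cost w <= \sum_(w' : traj M T) `|total_cost w'| by [].
apply: le_trans (ler_norm _) _; rewrite (bigD1 w) //= lerDl.
by apply: sumr_ge0.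
Qed.

(** * The least level with Bellman value at least [alpha] *)

Section OptimalLevel.
Variables (T : nat) (alpha : R) (halpha : 0 < alpha <= 1).
Let alpha_gt0 : 0 < alpha. Proof. by case/andP: halpha. Qed.
Let alpha_le1 : alpha <= 1. Proof. by case/andP: halpha. Qed.

(** Costs of tuples form a finite set, so one candidate suffices: a level reached surely by some
    policy is lowered into [Lambda0]. *)
Lemma opt_level_exists s :
  exists v, is_min [set lam | Lambda0 M T lam /\ alpha <= opt T s lam] v.
Proof.
pose c (h : T.-tuple (K M)) : R := \sum_(t < T) cost (tnth h t).
have [lam hlam] := success_eventually1 T.
pose u := dirac_policy (level_policy lam (greedy T)).
have hu : U_RH M T u by apply/dirac_policy_RH/level_policy_DH/greedy_DM.
have [|lam' [[h0 h0E] _] slam'] := @success_Lambda0 T u s lam; first by rewrite hlam.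
have P0 : alpha <= opt T s (c h0).
  by apply: le_trans (success_le_opt s (c h0) hu); rewrite -[c h0]h0E slam' hlam.
case: (@arg_minP _ _ _ h0 [pred h | alpha <= opt T s (c h)] c P0) => h /= hP hmin.
exists (c h); split; first by split=> //; exists h.
by move=> _ [[h' ->] /hmin].
Qed.

Variables (s : S) (v : R).
Hypothesis hv : is_min [set lam | Lambda0 M T lam /\ alpha <= opt T s lam] v.

Lemma opt_level_le u lam : U_RH M T u -> alpha <= success T u s lam -> v <= lam.
Proof.
move=> hu ha; have [|lam' [L' le'] s'] := @success_Lambda0 T u s lam.
  exact: lt_le_trans ha.
apply: le_trans le'; apply: (proj2 hv); split=> //.
by apply: le_trans (success_le_opt s lam' hu); rewrite s'.
Qed.

Lemma opt_level_le_VaR u : U_RH M T u -> v <= VaR M T alpha u s.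
Proof.
(* The set must be shown nonempty for [inf] to be a genuine infimum: it contains a level reached
   surely. *)
move=> hu; apply: lb_le_inf => [|lam]; last exact: opt_level_le.
have [lam hlam] := success_eventually1 T.
by exists lam; rewrite /= -/(success T u s lam) hlam.
Qed.

(** Stated for any policy reaching [alpha] at [v], so as to serve both the greedy policy and the
    induced one. *)
Lemma VaR_eq_opt_level u :
  U_RH M T u -> alpha <= success T u s v -> VaR M T alpha u s = v.
Proof.
move=> hu ha; apply/le_anti/andP; split; last exact: opt_level_le_VaR.
apply: ge_inf; last exact: ha.
by exists v => lam; apply: opt_level_le.
Qed.

Lemma VaR_optE : VaR_opt M T alpha s = v.
Proof.
have [[_ ha] _] := hv.
pose u := dirac_policy (level_policy v (greedy T)).
have hu : U_RH M T u by apply/dirac_policy_RH/level_policy_DH/greedy_DM.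
have uv : VaR M T alpha u s = v by apply: VaR_eq_opt_level; rewrite ?success_greedy.
apply/le_anti/andP; split.
  apply: ge_inf; last by exists u.
  by exists v => _ [u' hu' <-]; apply: opt_level_le_VaR.
by apply: lb_le_inf => [|_ [u' hu' <-]]; [exists v, u | apply: opt_level_le_VaR].
Qed.
End OptimalLevel.
End Trajectories.

Theorem theorem9 (R : realType) (S A : finType) (M : mdp R S A) (T : nat)
    (alpha : R) (hT : (1 <= T)%N) (halpha : 0 < alpha <= 1) :
  (forall s0 : S, exists Vmax : R -> R,
     (forall lam0 : R, Lambda0 M T lam0 ->
        is_max [set V0 M T (aug_dirac u) s0 lam0 | u in aug_DM M T]
               (Vmax lam0)) /\
     is_min [set lam0 : R | Lambda0 M T lam0 /\ alpha <= Vmax lam0]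
            (VaR_opt M T alpha s0)) /\
  (forall u : aug_dmpolicy R S A, aug_DM M T u -> aug_optimal M T u ->
     U_DH M T (induced_policy M T alpha u) /\
     forall s0 : S,
       VaR M T alpha (dirac_policy (induced_policy M T alpha u)) s0
       = VaR_opt M T alpha s0).
Proof.
split=> [s|g hg gopt].
  exists (opt M T s); split=> [lam _|].
    split; first by exists (greedy M T); [exact: greedy_DM | exact: V0_greedy].
    by move=> _ [g hg <-]; apply/V0_le_opt/aug_dirac_RH.
  by have [v hv] := opt_level_exists M T halpha s; rewrite (VaR_optE halpha hv).
have hDH : U_DH M T (induced_policy M T alpha g) by move=> h s hs; apply: hg.
split=> // s; have [v hv] := opt_level_exists M T halpha s.
rewrite (VaR_optE halpha hv); apply: (VaR_eq_opt_level halpha hv).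
  exact: dirac_policy_RH.
(* Tracking the level from [v], the optimal Markov policy succeeds with probability [opt T s v], at
   least [alpha] by the choice of [v]. *)
rewrite success_induced (VaR_optE halpha hv) -V0_dirac gopt sup_V0.
by case: hv => -[].
Qed.
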